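(* Let $n\ge 1$ and let $U$ be a weakly maxtame subset of $S^{n-1}$. Then there is a finite family $\mathcal H$ of open hemispheres of $S^{n-1}$ such that (i) each connected component of $U$ is an intersection of members of $\mathcal H$; and (ii) for each $H\in\mathcal H$, the closure of $H$ has a neighbourhood $N$ in $S^{n-1}$ such that $U\cap H=U\cap N$. In particular, distinct components of $U$ have disjoint closures.
   Context: $S^{n-1}$ is the unit sphere in $\mathbb R^n$. For a natural number $m$, an ''$m$-point subset'' means a non-empty subset with at most $m$ points. A finite subset of $\mathbb R^n$ is balanced if its convex hull contains the origin. A subset $V\subseteq S^{n-1}$ is $m$-tame if every $m$-point subset of $V$ is contained in some open hemisphere of $S^{n-1}$, equivalently if $V$ has no balanced $m$-point subsets. The open hemisphere centred at $v\in S^{n-1}$ is $\{x\in S^{n-1} : \langle x,v\rangle>0\}$. A subset $U$ of $S^{n-1}$ is weakly maxtame if $U$ is open and $n$-tame, the set $\pi_0(U)$ of its components is finite, and $U$ is maximal (under inclusion) amongst open $n$-tame subsets of $S^{n-1}$ with at most $|\pi_0(U)|$ components. *)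

(* Defs.v *)
From HB Require Import structures.
From mathcomp Require Import all_boot all_order all_algebra.
From mathcomp Require Import all_classical all_reals all_analysis.

Set Implicit Arguments.
Unset Strict Implicit.
Unset Printing Implicit Defensive.
Import Order.TTheory GRing.Theory Num.Theory.
Import numFieldNormedType.Exports.
Local Open Scope card_scope.
Local Open Scope classical_set_scope.
Local Open Scope ring_scope.

Definition dotp (R : realType) (n : nat) (x y : 'rV[R]_n) : R :=
  \sum_(i < n) x 0 i * y 0 i.

(* [sphere R n] is S^(n-1). Coerced to a type, it carries the subspace topology
   of the product topology on R^n; [open], [closure], [set_nbhs] and
   [connected_component] applied to [set (sphere R n)] are thus relative
   to the sphere. *)
Definition sphere (R : realType) (n : nat) : set 'rV[R]_n :=
  [set x | dotp x x = 1].
Arguments sphere R n : clear implicits.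

Definition hemisphere (R : realType) (n : nat) (v : sphere R n)
  : set (sphere R n) := [set x | 0 < dotp (\val x) (\val v)].

Definition point_subset (T : Type) (m : nat) (F : set T) : Prop :=
  F !=set0 /\ F #<= `I_m.

Definition tame (R : realType) (n m : nat) (V : set (sphere R n)) : Prop :=
  forall F : set (sphere R n), F `<=` V -> point_subset m F ->
    exists v : sphere R n, F `<=` hemisphere v.

(* Indexing by the points of [U] matters: [connected_component U x] is the empty
   set when [x] is not in [U]. *)
Definition components (T : topologicalType) (U : set T) : set (set T) :=
  connected_component U @` U.

Definition weakly_maxtame (R : realType) (n : nat) (U : set (sphere R n))
  : Prop :=
  [/\ open U, tame n U, finite_set (components U) &
      forall V : set (sphere R n), open V -> tame n V ->
        components V #<= components U -> U `<=` V -> V = U].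

(* Main.v *)
(* Let [U] be weakly maxtame.  By maximality, an open convex cone [K] that meets
   a component [C] of [U] and contains no point balanced by [n - 1] points of
   [U] lies over [C].
   If [n + 1] points vary continuously over a connected set and no [n] of them
   are ever balanced, then being balanced is an open condition (Cramer) and a
   closed one (Gordan), hence constant.  This shows that the cone over [C] is
   convex.
   For components [D 0, ..., D (n - 1)], the sum [K_D] of their cones is an open
   convex cone without 0.  The family of hemispheres consists of those [K_D]
   that are half-spaces.  Those containing [C] cut out exactly [C]: at a generic
   boundary point of [C], each other sum [K_D] involving [C] leaves a choice of
   functionals, one of which is positive there.  If [K_D = {v > 0}], the
   constancy principle, applied to a point of [U] just below [v^perp] and points
   of the [D i], gives the gap between [U /\ {v < 0}] and [v^perp]. *)
Require Import Defs.
From HB Require Import structures.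
From mathcomp Require Import all_boot all_order all_algebra.
From mathcomp Require Import all_classical all_reals all_analysis.
From mathcomp Require Import ring lra.

Set Implicit Arguments.
Unset Strict Implicit.
Unset Printing Implicit Defensive.
Import Order.TTheory GRing.Theory Num.Theory.
Import numFieldNormedType.Exports.
Local Open Scope card_scope.
Local Open Scope classical_set_scope.
Local Open Scope ring_scope.

(** * The Euclidean inner product and separation from a closed convex set *)

Section DotProduct.
Variables (R : realType) (n : nat).
Implicit Types (x y z v : 'rV[R]_n) (a : R).

Lemma dotpC x y : dotp x y = dotp y x.
Proof. by apply: eq_bigr => i _; rewrite mulrC. Qed.

Lemma dotpDl x y z : dotp (x + y) z = dotp x z + dotp y z.
Proof. by rewrite -big_split; apply: eq_bigr => i _; rewrite mxE mulrDl. Qed.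

Lemma dotpZl a x z : dotp (a *: x) z = a * dotp x z.
Proof. by rewrite mulr_sumr; apply: eq_bigr => i _; rewrite mxE mulrA. Qed.

Lemma dotpDr x y z : dotp z (x + y) = dotp z x + dotp z y.
Proof. by rewrite dotpC dotpDl !(dotpC _ z). Qed.

Lemma dotpZr a x z : dotp z (a *: x) = a * dotp z x.
Proof. by rewrite dotpC dotpZl dotpC. Qed.

Lemma dotpNl x z : dotp (- x) z = - dotp x z.
Proof. by rewrite -scaleN1r dotpZl mulN1r. Qed.

Lemma dotpNr x z : dotp z (- x) = - dotp z x.
Proof. by rewrite dotpC dotpNl dotpC. Qed.

Lemma dotp0l z : dotp 0 z = 0.
Proof. by rewrite -(scale0r 0) dotpZl mul0r. Qed.

Lemma dotp0r z : dotp z 0 = 0.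
Proof. by rewrite dotpC dotp0l. Qed.

Lemma dotp_suml (I : finType) (F : I -> 'rV[R]_n) z :
  dotp (\sum_i F i) z = \sum_i dotp (F i) z.
Proof.
apply: (big_morph (fun x => dotp x z)) => [x y|]; first exact: dotpDl.
exact: dotp0l.
Qed.

Lemma dotpp_ge0 x : 0 <= dotp x x.
Proof. by apply: sumr_ge0 => i _; rewrite -expr2 sqr_ge0. Qed.

Lemma dotpp_gt0 x : x != 0 -> 0 < dotp x x.
Proof.
apply: contraNT; rewrite -leNgt => x_le0; apply/eqP/rowP => i; rewrite mxE.
have x0 : dotp x x = 0 by apply/eqP; rewrite eq_le x_le0 dotpp_ge0.
have /psumr_eq0P/(_ x0 i isT)/eqP : forall j, true -> 0 <= x 0 j * x 0 j.
  by move=> j _; rewrite -expr2 sqr_ge0.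
by rewrite mulf_eq0 orbb => /eqP.
Qed.

Lemma sqr_coord_le_dotpp x i : x 0 i ^+ 2 <= dotp x x.
Proof.
rewrite /dotp (bigD1 i) //= -expr2 lerDl sumr_ge0 // => j _.
by rewrite -expr2 sqr_ge0.
Qed.

Lemma continuous_dotp (T : topologicalType) (f g : T -> 'rV[R]_n) :
  continuous f -> continuous g -> continuous (fun t => dotp (f t) (g t)).
Proof.
move=> cf cg; apply: continuous_big => [|i _]; first exact: add_continuous.
move=> t; apply: (@continuousM _ _ (fun t => f t 0 i) (fun t => g t 0 i)).
  exact: continuous_comp (cf t) (@coord_continuous _ _ _ _ _ _).
exact: continuous_comp (cg t) (@coord_continuous _ _ _ _ _ _).
Qed.

Lemma dotpl_continuous v : continuous (fun x => dotp x v).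
Proof. exact: continuous_dotp (fun=> cvg_id) (@cst_continuous _ _ _). Qed.

Lemma open_dotp_gt0 v : open [set x | 0 < dotp x v].
Proof.
apply: (@open_comp _ _ (fun x => dotp x v) [set t | 0 < t]).
  by move=> x _; exact: dotpl_continuous.
exact: open_gt.
Qed.

Lemma closed_dotp_ge0 v : closed [set x | 0 <= dotp x v].
Proof.
apply: (@closed_comp _ _ (fun x => dotp x v) [set t | 0 <= t]).
  by move=> x _; exact: dotpl_continuous.
exact: closed_ge.
Qed.

(* Compactness gives a nearest point to the origin, which then separates. *)
Lemma closed_convex_separation (M : set 'rV[R]_n) :
  closed M -> M !=set0 ->
  (forall x y t, M x -> M y -> 0 < t < 1 -> M ((1 - t) *: x + t *: y)) ->
  ~ M 0 -> exists v, forall x, M x -> 0 < dotp x v.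
Proof.
move=> clM [x0 Mx0] cvxM M0.
have cont : continuous (fun x : 'rV[R]_n => dotp x x).
  exact: continuous_dotp (fun=> cvg_id) (fun=> cvg_id).
pose A := M `&` [set x | dotp x x <= dotp x0 x0].
have clA : closed A.
  apply: closedI => //.
  apply: (@closed_comp _ _ (fun x : 'rV[R]_n => dotp x x) [set t | t <= dotp x0 x0]).
    by move=> x _; exact: cont.
  exact: closed_le.
(* A crude bound without square roots: [s ^+ 2 <= c] puts [s] between [- (1 + c)] and [1 + c]. *)
pose r := 1 + dotp x0 x0.
have coA : compact A.
  have coB : compact [set v : 'rV[R]_n | forall i, v ord0 i \in `[- r, r]].
    apply: (@rV_compact _ _ (fun=> `[- r, r]%classic)) => _.
    exact: segment_compact.
  apply: subclosed_compact clA coB _ => x [_ /= xr] i.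
  rewrite in_itv /= -ler_norml.
  have := le_trans (sqr_coord_le_dotpp x i) xr; rewrite -real_normK ?num_real//.
  have := normr_ge0 (x ord0 i); rewrite /r -/(ord0); nra.
have [y /set_mem [My yx0] ymin] : exists2 c, c \in A & forall t, t \in A ->
    dotp c c <= dotp t t.
  apply: EVT_min_rV => //; first by exists x0; split => //=.
  exact: continuous_subspaceT.
have {}ymin x : M x -> dotp y y <= dotp x x.
  move=> Mx; have [xx0|x0x] := leP (dotp x x) (dotp x0 x0).
    by apply: ymin; apply/mem_set; split.
  by rewrite (le_trans yx0)// ltW.
have y0 : 0 < dotp y y by apply: dotpp_gt0; apply/eqP => y0; rewrite y0 in My.
exists y => x Mx; rewrite ltNge; apply/negP => xy.
pose d := dotp (x - y) (x - y).
have dE : d = dotp x x - 2 * dotp x y + dotp y y.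
  by rewrite /d !(dotpDl, dotpDr, dotpNl, dotpNr) (dotpC y x); ring.
have d_gt : 0 < d.
  by rewrite dE; have := dotpp_ge0 x; move: xy y0; nra.
(* The step from [y] towards [x] is so short that [t * d] stays below [2 * (dotp y y - dotp x y)];
   hence the norm drops below its minimum. *)
pose t := Num.min (1 / 2) (dotp y y / d).
have t0 : 0 < t by rewrite lt_min divr_gt0// divr_gt0//.
have t1 : t < 1 by rewrite gt_min; apply/orP; left; lra.
have td : t * d <= dotp y y.
  by rewrite -ler_pdivlMr// ge_min lexx orbT.
have /ymin : M ((1 - t) *: y + t *: x) by apply: cvxM => //; rewrite t0 t1.
rewrite leNgt => /negP; apply.
rewrite [ltLHS](_ : _ = dotp y y + t * (t * d - 2 * (dotp y y - dotp x y))).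
  rewrite -[ltRHS]addr0 ltrD2l pmulr_rlt0//; lra.
by rewrite dE !(dotpDl, dotpDr, dotpZl, dotpZr) (dotpC y x); ring.
Qed.

End DotProduct.

Lemma open_forall (T : topologicalType) (I : finType) (P : I -> set T) :
  (forall i, open (P i)) -> open [set x | forall i, P i x].
Proof.
move=> oP; rewrite openE => x Px; apply: (@filter_forall _ _ P (nbhs x) _) => i.
by have := oP i; rewrite openE; apply.
Qed.

Lemma open_imply (T : topologicalType) (P : Prop) (A : set T) :
  open A -> open [set x | P -> A x].
Proof.
move=> oA; have [p|np] := pselect P.
  suff -> : [set x | P -> A x] = A by [].
  by apply/seteqP; split=> x /= => [|Ax _ //]; apply.
suff -> : [set x | P -> A x] = setT by exact: openT.
by apply/seteqP; split=> // x _ /np.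
Qed.

(** * Open convex cones, their separation from 0, and Gordan's alternative *)

Section OpenCones.
Variables (R : realType) (n : nat).
Implicit Types (x y z v : 'rV[R]_n) (K : set 'rV[R]_n).

Definition open_cone K : Prop :=
  [/\ open K, forall x y, K x -> K y -> K (x + y) &
      forall t x, 0 < t -> K x -> K (t *: x)].

(** This stands in for letting [e] tend to 0 in the separation arguments. *)
Lemma ge0_of_perturbation (a b : R) : (forall e, 0 < e -> 0 < a + e * b) -> 0 <= a.
Proof.
move=> ab; rewrite leNgt; apply/negP => a0.
have b1 : 0 < `|b| + 1 by rewrite ltr_wpDl.
have e0 : 0 < - a / (`|b| + 1) by rewrite divr_gt0// oppr_gt0.
have := ab _ e0; apply/negP; rewrite -leNgt.
have : - a / (`|b| + 1) * b <= - a / (`|b| + 1) * (`|b| + 1).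
  by rewrite ler_pM2l//; have := ler_norm b; lra.
rewrite divfK ?gt_eqF//; lra.
Qed.

Lemma open_line K x y : open K -> K x ->
  exists2 d, 0 < d & forall t, `|t| < d -> K (x + t *: y).
Proof.
move=> oK Kx.
have cf : continuous (fun t : R => x + t *: y).
  move=> t; apply: cvgD; first exact: cvg_cst.
  by apply: cvgZl; exact: cvg_id.
have : open [set t : R | K (x + t *: y)].
  by apply: (@open_comp _ _ (fun t : R => x + t *: y)) => // t _; exact: cf.
rewrite openE => /(_ 0); rewrite /interior /= scale0r addr0 => /(_ Kx).
move=> /nbhs_ballP[d /= d0 dK]; exists d => // t td; apply: dK.
by rewrite /ball /= sub0r normrN.
Qed.

Lemma open_dotp_ge0 K v : open K -> v != 0 ->
  (forall x, K x -> 0 <= dotp x v) -> forall x, K x -> 0 < dotp x v.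
Proof.
move=> oK v0 Kv x Kx; have [d d0 dK] := open_line (- v) oK Kx.
have /Kv : K (x + (d / 2) *: - v) by apply: dK; rewrite gtr0_norm; lra.
rewrite dotpDl dotpZl dotpNl; have := dotpp_gt0 v0; nra.
Qed.

(** Some [z] in [K] is so close to [x] that [x - z + y] is still in [K]; the two add up to
    [x + y]. *)
Lemma open_cone_closureD K x y : open_cone K -> closure K x -> K y -> K (x + y).
Proof.
move=> [oK KD _] Kx Ky.
have : nbhs x [set z | K (x - z + y)].
  have : open [set z | K (x - z + y)].
    apply: (@open_comp _ _ (fun z => x - z + y)) => // z _.
    exact: cvgD (cvgB (cvg_cst _) cvg_id) (cvg_cst _).
  by rewrite openE; apply => /=; rewrite subrr add0r.
by move=> /Kx[z [Kz /= /(KD _ _ Kz)]]; rewrite addrA addrCA subrr addr0.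
Qed.

(** [M] is the translate by [k] of the closure of [K]: closed, convex and without 0, so the
    nearest-point argument applies to it. Scaling carries the functional back to [K]. *)
Lemma open_cone_separation K : open_cone K -> K !=set0 -> ~ K 0 ->
  exists v, forall x, K x -> 0 < dotp x v.
Proof.
move=> cK [k Kk] K0; have [oK KD KZ] := cK.
pose M := [set x | forall e, 0 < e -> K (x + (e - 1) *: k)].
have Mk : M k.
  by move=> e e0; rewrite -[X in X + _]scale1r -scalerDl addrC subrK; exact: KZ.
have clM : closed M.
  move=> x xM e e0; have Ke : K ((e / 2) *: k) by apply: KZ => //; lra.
  suff /(open_cone_closureD cK)/(_ Ke) : closure K (x + (e / 2 - 1) *: k).
    by congr K; apply/rowP => i; rewrite !mxE; field.
  move=> B xB; have : nbhs x [set y | B (y + (e / 2 - 1) *: k)].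
    have cf : continuous (fun y => y + (e / 2 - 1) *: k).
      by move=> y; exact: cvgD cvg_id (cvg_cst _).
    exact: cf xB.
  move=> /xM[y [My By]]; exists (y + (e / 2 - 1) *: k); split => //.
  by apply: My; lra.
have M0 : ~ M 0.
  move=> /(_ (1 / 2)); rewrite add0r => Mh; apply: K0.
  have /KD/(_ (Mh _)) : K ((1 / 2) *: k) by apply: KZ => //; lra.
  have h0 : 1 / 2 + (1 / 2 - 1) = 0 :> R by lra.
  by rewrite -scalerDl h0 scale0r; apply; lra.
have [|x y t Mx My /andP[t0 t1] e e0|v Mv] := closed_convex_separation clM _ _ M0.
- by exists k.
- have -> : (1 - t) *: x + t *: y + (e - 1) *: k =
      (1 - t) *: (x + (e - 1) *: k) + t *: (y + (e - 1) *: k).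
    by rewrite !scalerDr addrACA -scalerDl subrK scale1r.
  by apply: KD; apply: KZ; rewrite ?subr_gt0//; [exact: Mx|exact: My].
have v0 : v != 0 by apply/eqP => v0; have := Mv _ Mk; rewrite v0 dotp0r ltxx.
exists v; apply: open_dotp_ge0 => // x Kx.
apply: (@ge0_of_perturbation _ (dotp k v)) => e e0.
have : M (e^-1 *: x + k).
  move=> d d0; rewrite -addrA -[X in _ + (X + _)]scale1r -scalerDl.
  by apply: KD; apply: KZ => //; [rewrite invr_gt0|lra].
move=> /Mv; rewrite dotpDl dotpZl -(pmulr_rgt0 _ e0) mulrDr mulrA.
by rewrite divff ?gt_eqF// mul1r.
Qed.

(** The coefficients are not normalized to sum 1, so vectors may be rescaled by positive factors.
    For points of the sphere this says that 0 is in their convex hull. *)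
Definition balanced m (g : 'I_m -> 'rV[R]_n) : Prop :=
  exists l : 'I_m -> R,
    [/\ forall i, 0 <= l i, exists i, 0 < l i & \sum_i l i *: g i = 0].

Lemma not_balanced m (g : 'I_m -> 'rV[R]_n) v :
  (forall i, 0 < dotp (g i) v) -> ~ balanced g.
Proof.
move=> gv [l [l0 [j lj] lg]].
have : 0 < dotp (\sum_i l i *: g i) v.
  rewrite dotp_suml (bigD1 j) //= dotpZl ltr_wpDr ?mulr_gt0//.
  by apply: sumr_ge0 => i _; rewrite dotpZl mulr_ge0// ltW.
by rewrite lg dotp0l ltxx.
Qed.

End OpenCones.

(* The open cone of those [a] lying strictly above some vector [(<g i, v>)_i]
   either contains 0, or is separated from 0 by the coefficients of a balanced
   combination. *)
Lemma gordan (R : realType) (n m : nat) (g : 'I_m -> 'rV[R]_n) :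
  (exists v, forall i, 0 < dotp (g i) v) \/ balanced g.
Proof.
pose K := [set a : 'rV[R]_m | exists v, forall i, dotp (g i) v < a 0 i].
have oK : open K.
  rewrite openE => a [v av]; rewrite /interior.
  have : open [set b : 'rV[R]_m | forall i, dotp (g i) v < b 0 i].
    apply: (@open_forall _ _ (fun i (b : 'rV[R]_m) => dotp (g i) v < b 0 i)) => i.
    apply: (@open_comp _ _ (fun b : 'rV[R]_m => b 0 i) [set t | dotp (g i) v < t]).
      by move=> b _; exact: coord_continuous.
    exact: open_gt.
  by rewrite openE => /(_ a av); apply: filterS => b bv; exists v.
have cK : open_cone K.
  split=> // [a b [v av] [w bw]|t a t0 [v av]].
    by exists (v + w) => i; rewrite dotpDr mxE ltrD.
  by exists (t *: v) => i; rewrite dotpZr mxE ltr_pM2l.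
have [[v gv]|K0] := pselect (K 0).
  left; exists (- v) => i; rewrite dotpNr oppr_gt0.
  by have := gv i; rewrite mxE.
pose one : 'rV[R]_m := const_mx 1.
have K1 v e : 0 < e -> K (\row_i dotp (g i) v + e *: one).
  by move=> e0; exists v => i; rewrite !mxE ltrDl mulr1.
right; have [|l Kl] := open_cone_separation cK _ K0.
  by exists (\row_i dotp (g i) 0 + 1 *: one); exact: K1.
have l0 i : 0 <= l 0 i.
  apply: (@ge0_of_perturbation _ _ (dotp one l)) => e e0.
  have : K (delta_mx 0 i + e *: one).
    by exists 0 => j; rewrite dotp0r !mxE mulr1 ltr_wpDl.
  move=> /Kl; rewrite dotpDl dotpZl; congr (0 < _ + _).
  rewrite /dotp (bigD1 i) //= mxE !eqxx mul1r big1 ?addr0// => j ji.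
  by rewrite mxE (negbTE ji) andbF mul0r.
exists (l 0); split => //.
- apply/not_existsP => lN; have l_eq0 : l = 0.
    apply/rowP => i; rewrite mxE; apply/eqP; rewrite eq_le l0 andbT leNgt.
    exact/negP.
  by have := Kl _ (K1 0 1 ltr01); rewrite l_eq0 dotp0r ltxx.
set w := \sum_i _.
have : 0 <= - dotp w w.
  apply: (@ge0_of_perturbation _ _ (dotp one l)) => e e0.
  have := Kl _ (K1 (- w) e e0); rewrite dotpDl dotpZl; congr (0 < _ + _).
  rewrite -dotpNr {2}/w dotp_suml; apply: eq_bigr => i _.
  by rewrite dotpZl mxE mulrC.
rewrite oppr_ge0 => w0; apply/eqP; apply: contraTT w0 => w0.
by rewrite -ltNge dotpp_gt0.
Qed.

(** * Cramer's rule and the constancy of balancedness over connected sets *)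

Lemma continuous_det (R : realType) (m : nat) (T : topologicalType)
    (A : T -> 'M[R]_m) :
  (forall i j, continuous (fun t => A t i j)) -> continuous (fun t => \det (A t)).
Proof.
move=> cA; apply: continuous_big => [|s _]; first exact: add_continuous.
move=> t; apply: (@continuousM R T (fun=> _) (fun t => \prod_i A t i _)).
  exact: cvg_cst.
by move: t; apply: continuous_big => [|i _]; [exact: mul_continuous|exact: cA].
Qed.

Lemma continuous_mul_adj (R : realType) (m : nat) (T : topologicalType)
    (A : T -> 'M[R]_m) (u : T -> 'rV[R]_m) (j : 'I_m) :
  (forall i j, continuous (fun t => A t i j)) ->
  (forall i, continuous (fun t => u t 0 i)) ->
  continuous (fun t => (u t *m \adj (A t)) 0 j).
Proof.
move=> cA cu; rewrite (_ : (fun t => _) =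
  fun t => \sum_i u t 0 i * \adj (A t) i j); last first.
  by apply/funext => t; rewrite mxE.
apply: continuous_big => [|i _]; first exact: add_continuous.
move=> t; apply: (@continuousM _ _ (fun t => u t 0 i)
  (fun t => \adj (A t) i j)); first exact: cu.
rewrite (_ : (fun t => _) = fun t => (-1) ^+ (j + i) *
    \det (row' j (col' i (A t)))); last first.
  by apply/funext => s; rewrite mxE.
apply: (@continuousM R T (fun=> (-1) ^+ (j + i))
  (fun t => \det (row' j (col' i (A t))))); first exact: cvg_cst.
apply: continuous_det => k l.
by under eq_fun do rewrite !mxE; exact: cA.
Qed.

Section Balanced.
Variables (R : realType) (n : nat) (n_gt0 : (0 < n)%N).
Implicit Types g : 'I_n.+1 -> 'rV[R]_n.

(** In effect, no [n] of the [n.+1] vectors are balanced. Families that are not balanced at all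
    qualify too, so the condition can hold along a whole path. *)
Definition minimally_balanced g : Prop :=
  forall l : 'I_n.+1 -> R, (forall i, 0 <= l i) -> \sum_i l i *: g i = 0 ->
    forall j, l j = 0 -> forall i, l i = 0.

(** The omitted vector [g ord0], negated, is the right-hand side of the system solved by Cramer's
    rule. *)
Definition tail_mx g : 'M[R]_n := \matrix_(i, j) g (lift ord0 i) 0 j.

Lemma mul_tail_mx (u : 'rV[R]_n) g :
  u *m tail_mx g = \sum_i u 0 i *: g (lift ord0 i).
Proof.
by apply/rowP => j; rewrite mxE summxE; apply: eq_bigr => i _; rewrite !mxE.
Qed.

(* A linear relation between [g 1, ..., g n] could be subtracted from the
   balanced combination until some coefficient vanishes. *)
Lemma det_tail_mx_neq0 g : minimally_balanced g -> balanced g ->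
  \det (tail_mx g) != 0.
Proof.
move=> mg [l [l_ge0 [k lk] lg]].
have l_gt0 i : 0 < l i.
  rewrite lt_neqAle l_ge0 andbT; apply/negP => /eqP/esym li0.
  by rewrite (mg l l_ge0 lg i li0) ltxx in lk.
apply/negP => /det0P[w w0 wg].
wlog [i0 wi0] : w w0 wg / exists i, 0 < w 0 i.
  move=> wlg; have [/wlg|/forallNP wN] := pselect (exists i, 0 < w 0 i).
    by apply.
  have [i wi] : exists i, w 0 i != 0.
    by apply/existsP; apply: contraR w0 => /existsPn wN0; apply/eqP/rowP => i;
      rewrite mxE; apply/eqP; rewrite -[_ == _]negbK wN0.
  apply: (wlg (- w)); rewrite ?oppr_eq0 ?mulNmx ?wg ?oppr0//.
  exists i; rewrite mxE oppr_gt0 lt_neqAle wi leNgt; apply/negP; exact: wN.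
case: (@Order.TotalTheory.arg_minP _ _ _ i0 (fun i => 0 < w 0 i)
  (fun i => l (lift ord0 i) / w 0 i) wi0) => j wj jmin.
pose c := l (lift ord0 j) / w 0 j.
have c_gt0 : 0 < c by rewrite divr_gt0.
pose l' k := if unlift ord0 k is Some i then l k - c * w 0 i else l k.
have l'0 : l' ord0 = l ord0 by rewrite /l' unlift_none.
have l'S i : l' (lift ord0 i) = l (lift ord0 i) - c * w 0 i by rewrite /l' liftK.
have /(_ (lift ord0 j))/(_ _ ord0) : forall j, l' j = 0 -> forall i, l' i = 0.
  apply: mg => [i|].
    have [i' ->|->] := unliftP ord0 i; last by rewrite l'0.
    rewrite l'S subr_ge0; have [wi|wi] := ltP 0 (w 0 i').
      by rewrite -ler_pdivlMr//; exact: jmin.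
    by rewrite (le_trans _ (l_ge0 _))// pmulr_rle0.
  rewrite big_ord_recl l'0.
  under eq_bigr do rewrite l'S scalerBl -scalerA.
  rewrite big_split /= sumrN -scaler_sumr -mul_tail_mx wg scaler0 subr0.
  by rewrite -[RHS]lg [in RHS]big_ord_recl.
rewrite l'S l'0 /c divfK ?gt_eqF// subrr => /(_ erefl) l0.
by have := l_gt0 ord0; rewrite l0 ltxx.
Qed.

(* By Cramer's rule the combination is, up to scaling,
   [d ^+ 2 *: g 0 + \sum_i (d * u 0 i) *: g i]. *)
Lemma balanced_cramer g (d := \det (tail_mx g))
    (u := - g ord0 *m \adj (tail_mx g)) :
  (forall i, 0 < u 0 i * d) -> balanced g.
Proof.
move=> ud; have d0 : d != 0.
  apply/eqP => d0; have := ud (Ordinal n_gt0).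
  by rewrite d0 mulr0 ltxx.
exists (fun k => if unlift ord0 k is Some i then u 0 i * d else d ^+ 2); split.
- by move=> k; case: unlift => [i|]; rewrite ?sqr_ge0// ltW.
- by exists ord0; rewrite unlift_none exprn_even_gt0.
- rewrite big_ord_recl unlift_none.
  under eq_bigr do rewrite liftK mulrC -scalerA.
  rewrite -scaler_sumr -mul_tail_mx -mulmxA mul_adj_mx mul_mx_scalar.
  by rewrite -/d scalerN scalerN scalerA -expr2 subrr.
Qed.

(** Multiplying the relation by the adjugate turns [l ord0 * u 0 i] into [l (lift ord0 i) * d]. By
    minimality all coefficients are positive, so [u 0 i * d] has the sign of [d ^+ 2]. *)
Lemma cramer_balanced g (d := \det (tail_mx g))
    (u := - g ord0 *m \adj (tail_mx g)) :
  minimally_balanced g -> balanced g -> forall i, 0 < u 0 i * d.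
Proof.
move=> mg bg i; have d0 := det_tail_mx_neq0 mg bg; case: bg => l [l_ge0 [k lk] lg].
have l_gt0 j : 0 < l j.
  rewrite lt_neqAle l_ge0 andbT; apply/negP => /eqP/esym lj0.
  by rewrite (mg l l_ge0 lg j lj0) ltxx in lk.
pose L := \row_i l (lift ord0 i).
have : l ord0 *: - g ord0 = L *m tail_mx g.
  rewrite mul_tail_mx scalerN; apply/eqP; rewrite eq_sym -subr_eq0 opprK addrC.
  rewrite -[X in _ == X]lg big_ord_recl; apply/eqP; congr (_ + _).
  by apply: eq_bigr => j _; rewrite mxE.
move=> /(congr1 (mulmx^~ (\adj (tail_mx g)))).
rewrite -scalemxAl -mulmxA mul_mx_adj mul_mx_scalar -/u -/d => /rowP/(_ i).
rewrite !mxE => lu; rewrite -(pmulr_rgt0 _ (l_gt0 ord0)) mulrA lu.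
by rewrite mulrAC -expr2 pmulr_rgt0// exprn_even_gt0.
Qed.

(* Being balanced is a closed condition by Gordan's alternative, and among
   minimally balanced families an open one by Cramer's rule. *)
Lemma balanced_connected (T : topologicalType) (A : set T)
    (g : T -> 'I_n.+1 -> 'rV[R]_n) :
  connected A -> (forall i, continuous (fun t => g t i)) ->
  (forall t, A t -> minimally_balanced (g t)) ->
  forall s t, A s -> A t -> balanced (g s) -> balanced (g t).
Proof.
move=> cA cg mg s t As At bs.
suff /seteqP[_ /(_ t At)[]] : A `&` [set t | balanced (g t)] = A by [].
apply: cA; first by exists s.
- have cgc i j : continuous (fun t => g t i 0 j).
    by move=> x; exact: continuous_comp (cg i x) (@coord_continuous _ _ _ _ _ _).
  pose d t := \det (tail_mx (g t)).
  pose u t := - g t ord0 *m \adj (tail_mx (g t)).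
  exists [set t | forall i, 0 < u t 0 i * d t].
    apply: (@open_forall _ _ (fun i t => 0 < u t 0 i * d t)) => i.
    have ctail k l : continuous (fun t => tail_mx (g t) k l).
      by under eq_fun do rewrite mxE; exact: cgc.
    apply: (@open_comp _ _ (fun t => u t 0 i * d t) [set r | 0 < r]).
      move=> x _; apply: continuousM; last exact: continuous_det.
      apply: continuous_mul_adj => // j.
      under eq_fun do rewrite mxE; move=> y.
      by apply: (@continuousN R R T (fun y => g y ord0 0 j)); exact: cgc.
    exact: open_gt.
  apply/seteqP; split=> r [Ar br]; split => //.
    by move=> i; exact: cramer_balanced (mg _ Ar) br i.
  exact: balanced_cramer br.
- exists [set t | balanced (g t)] => //.
  rewrite -openC openE => r /= nbr; rewrite /interior.
  have [[v gv]|//] := gordan (g r).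
  have : open [set t | forall i, 0 < dotp (g t i) v].
    apply: (@open_forall _ _ (fun i t => 0 < dotp (g t i) v)) => i.
    apply: (@open_comp _ _ (fun t => g t i) [set x | 0 < dotp x v]).
      by move=> x _; exact: cg.
    exact: open_dotp_gt0.
  rewrite openE => /(_ r gv); apply: filterS => x; exact: not_balanced.
Qed.

End Balanced.

(** * The sphere, the cones over its subsets, and connected components *)

Section SphereCones.
Variables (R : realType) (n : nat).
Implicit Types (x y : 'rV[R]_n) (p q : sphere R n) (C U V : set (sphere R n)).
Implicit Types K : set 'rV[R]_n.

Lemma dotp_sphere p : dotp (\val p) (\val p) = 1.
Proof. exact: set_mem (valP p). Qed.

Lemma sphere_neq0 p : \val p != 0.
Proof.
by apply/eqP => p0; have := dotp_sphere p; rewrite p0 dotp0l => /eqP;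
  rewrite eq_sym oner_eq0.
Qed.

Lemma val_sphere_continuous : continuous (\val : sphere R n -> 'rV[R]_n).
Proof. exact: initial_continuous. Qed.

Lemma open_sphereE U : open U -> exists2 W : set 'rV[R]_n, open W & U = \val @^-1` W.
Proof.
move=> oU; have : @open (initial_topology (\val : sphere R n -> 'rV[R]_n)) U by [].
by move=> [W oW <-]; exists W.
Qed.

Lemma open_val_preimage K : open K -> open [set p : sphere R n | K (\val p)].
Proof.
by apply: open_comp => p _; exact: val_sphere_continuous.
Qed.

Definition normalize x : 'rV[R]_n := (Num.sqrt (dotp x x))^-1 *: x.

Lemma sqrt_dotpp_gt0 x : x != 0 -> 0 < Num.sqrt (dotp x x).
Proof. by move=> x0; rewrite sqrtr_gt0 dotpp_gt0. Qed.

Lemma sphere_normalize x : x != 0 -> sphere R n (normalize x).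
Proof.
move=> x0; have s0 := sqrt_dotpp_gt0 x0.
rewrite /sphere /= /normalize dotpZl dotpZr mulrA -invfM -expr2.
by rewrite sqr_sqrtr ?dotpp_ge0// mulVf// gt_eqF// dotpp_gt0.
Qed.

Lemma normalize_scale t p : 0 < t -> normalize (t *: \val p) = \val p.
Proof.
move=> t0; rewrite /normalize dotpZl dotpZr dotp_sphere mulr1 -expr2.
by rewrite sqrtr_sqr gtr0_norm// scalerA mulVf ?scale1r// gt_eqF.
Qed.

Lemma normalize_continuous x : x != 0 -> {for x, continuous normalize}.
Proof.
move=> x0; apply: (@continuousZ _ _ _ (fun y => (Num.sqrt (dotp y y))^-1) id) => //.
apply: continuousV; first by rewrite gt_eqF// sqrt_dotpp_gt0.
apply: (@continuous_comp _ _ _ (fun y : 'rV[R]_n => dotp y y) Num.sqrt).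
  exact: continuous_dotp (fun=> cvg_id) (fun=> cvg_id) _.
exact: sqrt_continuous.
Qed.

Lemma lift_to_sphere (T : topologicalType) (h : T -> 'rV[R]_n) :
  continuous h -> (forall t, h t != 0) ->
  exists2 f : T -> sphere R n, continuous f & forall t, \val (f t) = normalize (h t).
Proof.
move=> ch h0; pose f t : sphere R n := SigSub (mem_set (sphere_normalize (h0 t))).
exists f => //; apply: continuous_comp_initial => t.
exact: continuous_comp (ch t) (normalize_continuous (h0 t)).
Qed.

Definition cone_over C : set 'rV[R]_n :=
  [set y | exists t p, [/\ 0 < t, C p & y = t *: \val p]].

Lemma cone_over_val C p : C p -> cone_over C (\val p).
Proof. by move=> Cp; exists 1, p; rewrite scale1r. Qed.

Lemma cone_overZ C t x : 0 < t -> cone_over C x -> cone_over C (t *: x).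
Proof.
by move=> t0 [s [p [s0 Cp ->]]]; exists (t * s), p; rewrite scalerA mulr_gt0.
Qed.

Lemma cone_overS C U : C `<=` U -> cone_over C `<=` cone_over U.
Proof. by move=> CU x [t [p [t0 Cp ->]]]; exists t, p; split => //; exact: CU. Qed.

Lemma cone_over0 C : ~ cone_over C 0.
Proof.
move=> [t [p [t0 _ /esym/eqP]]]; rewrite scaler_eq0 gt_eqF//=.
by rewrite (negbTE (sphere_neq0 p)).
Qed.

Lemma cone_over_valK C p : cone_over C (\val p) -> C p.
Proof.
move=> [t [q [t0 Cq pq]]]; have := normalize_scale q t0.
rewrite -pq -[X in normalize X]scale1r normalize_scale// => pq'.
by rewrite (val_inj pq').
Qed.

Lemma coneP x : x != 0 -> exists t p, 0 < t /\ x = t *: \val p.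
Proof.
move=> x0; pose p : sphere R n := SigSub (mem_set (sphere_normalize x0)).
exists (Num.sqrt (dotp x x)), p; split; first exact: sqrt_dotpp_gt0.
by rewrite /= /normalize scalerA divff ?scale1r// gt_eqF// sqrt_dotpp_gt0.
Qed.

Lemma open_cone_over U : open U -> open (cone_over U).
Proof.
move=> /open_sphereE[W oW ->].
(* [normalize] sends 0 to 0, so the second condition removes exactly the apex. *)
rewrite (_ : cone_over _ = normalize @^-1` (W `&` [set x | 0 < dotp x x])).
  apply: open_comp.
    move=> x /set_mem [_ /= Nx]; apply: normalize_continuous.
    by apply/eqP => x0; move: Nx; rewrite x0 /normalize scaler0 dotp0l ltxx.
  apply: openI => //.
  apply: (@open_comp _ _ (fun x : 'rV[R]_n => dotp x x) [set t | 0 < t]).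
    move=> x _; exact: continuous_dotp (fun=> cvg_id) (fun=> cvg_id) _.
  exact: open_gt.
apply/seteqP; split=> [x [t [p [t0 Wp ->]]]|x [Wx Nx]] /=.
  by rewrite normalize_scale// dotp_sphere ltr01.
have x0 : x != 0.
  by apply/eqP => x0; move: Nx; rewrite /= x0 /normalize scaler0 dotp0l ltxx.
have [t [p [t0 xE]]] := coneP x0; exists t, p; split => //=.
by move: Wx; rewrite xE normalize_scale.
Qed.

(* The weights [(1 - t)^2] and [t^2] keep the path inside the cone for every
   real [t], so that it can be normalized without restricting its domain. *)
Lemma open_cone_connected K : open_cone K -> ~ K 0 ->
  connected [set p : sphere R n | K (\val p)].
Proof.
move=> [_ KD KZ] K0.
have path p q : K (\val p) -> K (\val q) -> exists B : set (sphere R n),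
    [/\ connected B, B `<=` [set p | K (\val p)], B p & B q].
  move=> Kp Kq; pose h t := (1 - t) ^+ 2 *: \val p + t ^+ 2 *: \val q.
  have Kh t : K (h t).
    rewrite /h; have [->|t0] := eqVneq t 0.
      by rewrite subr0 expr1n expr0n scale1r scale0r addr0.
    have [->|t1] := eqVneq t 1; first by rewrite subrr expr1n expr0n scale0r add0r scale1r.
    by apply: KD; apply: KZ => //; rewrite exprn_even_gt0//= subr_eq0 eq_sym.
  have ch : continuous h.
    move=> t; apply: cvgD; apply: cvgZl.
      by apply: cvgM; apply: cvgB; (exact: cvg_cst || exact: cvg_id).
    by apply: cvgM; exact: cvg_id.
  have h0 t : h t != 0 by apply/eqP => h0; apply: K0; rewrite -h0.
  have [f cf fE] := lift_to_sphere ch h0.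
  exists (f @` `[0, 1]); split.
  - apply: connected_continuous_connected; first exact: segment_connected.
    exact: continuous_subspaceT.
  - move=> _ [t _ <-] /=; rewrite fE; apply: KZ => //.
    by rewrite invr_gt0 sqrt_dotpp_gt0.
  - exists 0; first by rewrite /= in_itv /= lexx ler01.
    apply: val_inj; rewrite fE /h subr0 expr1n expr0n scale0r addr0.
    by rewrite normalize_scale.
  - exists 1; first by rewrite /= in_itv /= lexx ler01.
    apply: val_inj; rewrite fE /h subrr expr1n expr0n scale0r add0r.
    by rewrite normalize_scale.
move=> B [p Bp] B1 B2; apply/seteqP; split=> [q|q Kq].
  by case: B1 => C _ -> [].
have Kp : K (\val p) by case: B1 Bp => C _ -> [].
have [A [cA AK Ap Aq]] := path _ _ Kp Kq.
suff /seteqP[_ /(_ q Aq)[]] : A `&` B = A by [].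
apply: cA; first by exists p.
- case: B1 => C oC ->; exists C => //; apply/seteqP; split=> r [Ar].
    by move=> [].
  by move=> Cr; split => //; split => //; exact: AK.
- case: B2 => C oC ->; exists C => //; apply/seteqP; split=> r [Ar].
    by move=> [].
  by move=> Cr; split => //; split => //; exact: AK.
Qed.

(** The cone spanned by a small ball about [x] inside [W]. *)
Lemma small_open_cone (W : set 'rV[R]_n) x : open W ->
  (forall t y, 0 < t -> W y -> W (t *: y)) -> W x ->
  exists K, [/\ open_cone K, K x & K `<=` W].
Proof.
rewrite openE => /(_ x) /[swap] WZ /[apply] /nbhs_ballP[e /= e0 eW].
exists [set y | exists2 t, 0 < t & ball x e (t *: y)]; split.
- split=> [|y z [s s0 sy] [t t0 tz]|t y t0 [s s0 sy]].
  + rewrite (_ : mkset _ = \bigcup_(t in [set t | 0 < t]) [set y | ball x e (t *: y)]).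
      apply: bigcup_open => t _.
      apply: (@open_comp _ _ (fun y => t *: y) (ball x e)).
        by move=> y _; exact: scaler_continuous.
      exact: ball_open.
    by apply/seteqP; split=> y [t t0 ty]; exists t.
  + have st : 0 < s + t by rewrite addr_gt0.
    have hs : 0 < s / (s + t) by rewrite divr_gt0.
    have ht : 0 < t / (s + t) by rewrite divr_gt0.
    (* This factor turns [y + z] into the convex combination of [s *: y] and [t *: z] with weights
       [t / (s + t)] and [s / (s + t)]. *)
    exists (s * t / (s + t)); first by rewrite divr_gt0// mulr_gt0.
    move: sy tz; rewrite -ball_normE /= => sy tz.
    have -> : x - (s * t / (s + t)) *: (y + z) =
        (t / (s + t)) *: (x - s *: y) + (s / (s + t)) *: (x - t *: z).
      by apply/rowP => i; rewrite !mxE; field; rewrite gt_eqF//.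
    rewrite (le_lt_trans (ler_normD _ _))//.
    rewrite (normrZ (t / (s + t))) (normrZ (s / (s + t))).
    rewrite (gtr0_norm hs) (gtr0_norm ht).
    have -> : e = t / (s + t) * e + s / (s + t) * e.
      by field; rewrite gt_eqF//.
    by apply: ltrD; rewrite ltr_pM2l.
  + exists (s / t); first by rewrite divr_gt0.
    by rewrite scalerA divfK// gt_eqF.
- by exists 1 => //; rewrite scale1r; exact: ballxx.
- move=> y [t t0 /eW Wty]; have := WZ t^-1 _ _ Wty.
  by rewrite scalerA mulVf ?gt_eqF// scale1r invr_gt0; apply.
Qed.

Lemma connected_component_subset U C V p : components U C -> C p -> V p ->
  V `<=` U -> connected V -> V `<=` C.
Proof.
move=> [q Uq <-] Cp Vp VU cV; rewrite (same_connected_component Cp).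
exact: connected_component_max.
Qed.

Lemma component_subset U C : components U C -> C `<=` U.
Proof. by move=> [p Up <-]; exact: connected_component_sub. Qed.

Lemma component_nonempty U C : components U C -> C !=set0.
Proof. by move=> [p Up <-]; exists p; exact: connected_component_refl. Qed.

Lemma connected_components U C : components U C -> connected C.
Proof. by move=> [p Up <-]; exact: component_connected. Qed.

Lemma components_eq U C D p : components U C -> components U D -> C p -> D p ->
  C = D.
Proof.
move=> cC cD Cp Dp; apply/seteqP; split.
  exact: connected_component_subset cD Dp Cp (component_subset cC) (connected_components cC).
exact: connected_component_subset cC Cp Dp (component_subset cD) (connected_components cD).
Qed.

(** Local connectedness of the sphere: small open convex cones cut out connected neighbourhoods. *)
Lemma open_component U C : open U -> components U C -> open C.
Proof.
move=> oU cC; rewrite openE => p Cp; rewrite /interior.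
have Up := component_subset cC Cp.
have [K [cK Kp KU]] := small_open_cone (open_cone_over oU)
  (@cone_overZ U) (cone_over_val Up).
have : nbhs p [set q : sphere R n | K (\val q)].
  by have [oK _ _] := cK; have := open_val_preimage oK; rewrite openE; apply.
apply: filterS; apply: (connected_component_subset cC Cp) => //.
  by move=> q /= /KU /cone_over_valK.
by apply: open_cone_connected => // /KU; exact: cone_over0.
Qed.

(** Sending a component of [U] to the component of [V] around it is surjective. The union in [f]
    defines this map without choosing points. *)
Lemma card_components_le U V : U `<=` V ->
  (forall p, V p -> exists2 q, U q & connected_component V p q) ->
  components V #<= components U.
Proof.
move=> UV VU.
pose f (C : set (sphere R n)) := \bigcup_(p in C) connected_component V p.
rewrite (_ : components V = f @` components U); first exact: card_image_le.
have fE q : U q -> f (connected_component U q) = connected_component V q.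
  move=> Uq; apply/seteqP; split=> [r [p Up Vr]|r Vr]; last first.
    by exists q => //; exact: connected_component_refl.
  rewrite (@same_connected_component _ _ q p)//.
  apply: (@connected_component_max _ _ (connected_component U q)) => //.
  - exact: connected_component_refl.
  - by apply: subset_trans UV; exact: connected_component_sub.
  - exact: component_connected.
apply/seteqP; split=> [_ [p Vp <-]|_ [_ [q Uq <-] <-]].
  have [q Uq pq] := VU _ Vp; exists (connected_component U q); first by exists q.
  by rewrite fE// -(same_connected_component pq).
by rewrite fE//; exists q => //; exact: UV.
Qed.

End SphereCones.

(** * Tameness in terms of balanced families, and the use of maximality *)

Section Tame.
Variables (R : realType) (n : nat) (n_gt0 : (0 < n)%N).
Implicit Types (U V C : set (sphere R n)) (K : set 'rV[R]_n).

Lemma tame_not_balanced U (f : 'I_n -> 'rV[R]_n) : tame n U ->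
  (forall i, cone_over U (f i)) -> ~ balanced f.
Proof.
move=> tU /choice[t /choice[x fE]]; pose i0 := Ordinal n_gt0.
(* The default [i0] extends the family to all naturals, so its image over the first [n] of them has
   at most [n] points. *)
pose F := (fun k => x (insubd i0 k)) @` `I_n.
have Fx i : F (x i) by exists i => //=; rewrite valKd.
have [||v Fv] := tU F.
- by move=> _ [k _ <-]; case: (fE (insubd i0 k)).
- by split; [exists (x i0)|exact: card_image_le].
apply: (@not_balanced _ _ _ _ (\val v)) => i; have [ti _ ->] := fE i.
by rewrite dotpZl mulr_gt0//; exact: Fv.
Qed.

Lemma not_balanced_tame V :
  (forall x : 'I_n -> sphere R n, (forall i, V (x i)) ->
     ~ balanced (fun i => \val (x i))) -> tame n V.
Proof.
move=> nb F FV [[p0 Fp0] /pcard_leP[h]].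
have hinj : {in F &, injective h} by exact: inj.
have hn p : F p -> (h p < n)%N by move=> Fp; exact: (@funS _ _ _ _ h _ Fp).
have /choice[x xF] : forall i : 'I_n, exists q, F q /\ forall p, F p -> h p = i -> q = p.
  move=> i; have [[q [Fq hq]]|nq] := pselect (exists q, F q /\ h q = i).
    exists q; split=> // p Fp hp; apply: hinj; rewrite ?inE//.
    by rewrite hq hp.
  by exists p0; split => // p Fp hp; exfalso; apply: nq; exists p.
have [[v xv]|] := gordan (fun i => \val (x i)); last first.
  by move/nb => []// i; apply: FV; case: (xF i).
have v0 : v != 0.
  by apply/eqP => v0; have := xv (Ordinal n_gt0); rewrite v0 dotp0r ltxx.
have [t [q [t0 vE]]] := coneP v0; exists q => p Fp.
have [_ /(_ p Fp erefl) <-] := xF (Ordinal (hn p Fp)).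
have := xv (Ordinal (hn p Fp)).
by rewrite vE dotpZr pmulr_rgt0.
Qed.

Lemma open_cone_sum K (I : finType) (P : pred I) (z : I -> 'rV[R]_n) j :
  open_cone K -> P j -> K (z j) -> (forall i, P i -> z i = 0 \/ K (z i)) ->
  K (\sum_(i | P i) z i).
Proof.
move=> [_ KD _] Pj Kj Kz; rewrite (bigD1 j)//=.
have [->|] : \sum_(i | P i && (i != j)) z i = 0 \/
    K (\sum_(i | P i && (i != j)) z i).
- apply: (big_ind (fun y => y = 0 \/ K y)); first by left.
    move=> x y [->|Kx] [->|Ky]; rewrite ?addr0 ?add0r; [by left|by right|by right|].
    by right; exact: KD.
  by move=> i /andP[Pi _]; exact: Kz.
- by rewrite addr0.
- exact: KD.
Qed.

(** [K] cuts out a connected set meeting [C], so adding it to [U] creates no new component. If [n]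
    points of the union were balanced, those in [K] would either contribute a vector of [K] balanced
    by the others, or all have coefficient 0; so the union is tame. The condition [b j = 0] encodes
    [n - 1] points without changing the index type. *)
Lemma maximal_cone U C K : weakly_maxtame U -> components U C -> open_cone K ->
  (exists2 p, C p & K (\val p)) ->
  (forall k (x : 'I_n -> sphere R n) (b : 'I_n -> R) j, K k ->
     (forall i, U (x i)) -> (forall i, 0 <= b i) -> b j = 0 ->
     k + \sum_i b i *: \val (x i) != 0) ->
  forall p, K (\val p) -> C p.
Proof.
move=> [oU tU _ maxU] cC cK [p0 Cp0 Kp0] KU p Kp.
have Up0 := component_subset cC Cp0.
have K0 : ~ K 0.
  move=> K0; have := KU 0 (fun=> p0) (fun=> 0) (Ordinal n_gt0) K0.
  rewrite big1 ?addr0 ?eqxx => [|i _]; last by rewrite scale0r.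
  by move=> /(_ (fun=> Up0)) /(_ (fun=> lexx 0)) /(_ erefl).
pose V := [set q : sphere R n | K (\val q)].
have cV : connected V by exact: open_cone_connected.
suff UVE : U `|` V = U.
  apply: (connected_component_subset cC Cp0 (Kp0 : V p0)) => //.
  by rewrite -UVE; exact: subsetUr.
apply: maxU; last exact: subsetUl.
- by apply: openU => //; apply: open_val_preimage; case: cK.
- apply: not_balanced_tame => x UVx [l [l0 [j lj] lx]].
  pose P i := `[< V (x i) >].
  (* Points in [V] give way to the filler [p0] with coefficient 0, which keeps the family in [U]. *)
  pose x' i := if P i then p0 else x i.
  pose b i := if P i then 0 else l i.
  have Ux' i : U (x' i).
    rewrite /x'; case: ifPn => // /asboolPn nV.
    by case: (UVx i).
  have b0 i : 0 <= b i by rewrite /b; case: ifP.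
  have lxE : \sum_(i | P i) l i *: \val (x i) + \sum_i b i *: \val (x' i) = 0.
    rewrite -[RHS]lx [RHS](bigID P) /=; congr (_ + _).
    rewrite (bigID P) /= big1 ?add0r => [|i Pi]; last by rewrite /b Pi scale0r.
    by apply: eq_bigr => i /negbTE Pi; rewrite /b /x' Pi.
  have [[i [Pi li]]|nP] := pselect (exists i, P i /\ 0 < l i).
    have /KU : K (\sum_(i | P i) l i *: \val (x i)).
      have [_ _ KZ] := cK.
      apply: (open_cone_sum cK Pi); first by apply: KZ => //; exact/asboolP.
      move=> k /asboolP Vk; have [->|lk] := eqVneq (l k) 0.
        by left; rewrite scale0r.
      by right; apply: KZ => //; rewrite lt_neqAle eq_sym lk l0.
    move=> /(_ x' b i Ux' b0); rewrite lxE eqxx /b Pi.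
    by move=> /(_ erefl).
  apply: (tame_not_balanced (f := fun i => \val (x' i)) tU).
    by move=> i; exact/cone_over_val.
  exists b; split => //.
    exists j; rewrite /b; case: ifPn => // Pj.
    by exfalso; apply: nP; exists j.
  rewrite -[RHS]lxE [X in _ = X + _]big1 ?add0r// => i Pi.
  have [->|li] := eqVneq (l i) 0; first by rewrite scale0r.
  by exfalso; apply: nP; exists i; rewrite lt_neqAle eq_sym li l0.
- apply: card_components_le; first exact: subsetUl.
  move=> q [Uq|Vq].
    by exists q => //; apply: connected_component_refl; left.
  by exists p0 => //; apply: (@connected_component_max _ _ V).
Qed.

End Tame.

(** * Minkowski sums of cones, positive functionals and generic points *)

Section MinkowskiSums.
Variables (R : realType) (n : nat).
Implicit Types (x y v : 'rV[R]_n) (K : set 'rV[R]_n).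

Definition minkowski_sum (I : finType) (F : I -> set 'rV[R]_n) : set 'rV[R]_n :=
  [set y | exists2 f : I -> 'rV[R]_n, (forall i, F i (f i)) & y = \sum_i f i].

Lemma open_cone_minkowski_sum (I : finType) (i0 : I) (F : I -> set 'rV[R]_n) :
  (forall i, open_cone (F i)) -> open_cone (minkowski_sum F).
Proof.
move=> cF; split=> [|_ _ [f Ff ->] [g Fg ->]|t _ t0 [f Ff ->]].
- rewrite (_ : minkowski_sum F = \bigcup_(f in [set f | forall i, F i (f i)])
      [set y | F i0 (y - \sum_(i | i != i0) f i)]).
    apply: bigcup_open => f Ff; have [oF _ _] := cF i0.
    apply: (@open_comp _ _ (fun y => y - \sum_(i | i != i0) f i)) => // y _.
    exact: cvgB cvg_id (cvg_cst _).
  apply/seteqP; split=> [_ [f Ff ->]|y [f Ff Fy]].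
    by exists f => //=; rewrite (bigD1 i0)//= addrK.
  exists (fun i => if i == i0 then y - \sum_(i | i != i0) f i else f i).
    by move=> i; case: eqP => [->|].
  rewrite (bigD1 i0)//= eqxx [X in _ = _ + X](eq_bigr f) ?subrK// => i.
  by move=> /negbTE ->.
- exists (fun i => f i + g i); last by rewrite big_split.
  by move=> i; have [_ FD _] := cF i; exact: FD.
- exists (fun i => t *: f i); last by rewrite scaler_sumr.
  by move=> i; have [_ _ FZ] := cF i; exact: FZ.
Qed.

(** Shrinking the other summands by a factor [e] tending to 0 gives nonnegativity on [F i]; openness
    makes it strict. *)
Lemma minkowski_sum_gt0 (I : finType) (F : I -> set 'rV[R]_n) v :
  (forall i, open_cone (F i)) -> (forall i, F i !=set0) ->
  (forall y, minkowski_sum F y -> 0 < dotp y v) ->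
  forall i x, F i x -> 0 < dotp x v.
Proof.
move=> cF /choice[f Ff] Fv i; have [oF _ _] := cF i.
apply: open_dotp_ge0 => // [|x Fx].
  apply/eqP => v0; have : minkowski_sum F (\sum_i f i) by exists f.
  by move=> /Fv; rewrite v0 dotp0r ltxx.
apply: (@ge0_of_perturbation _ _ (dotp (\sum_(j | j != i) f j) v)) => e e0.
suff : minkowski_sum F (x + e *: \sum_(j | j != i) f j).
  by move=> /Fv; rewrite dotpDl dotpZl.
exists (fun j => if j == i then x else e *: f j).
  by move=> j; case: eqP => [->//|_]; have [_ _ FZ] := cF j; exact: FZ.
rewrite [RHS](bigD1 i)//= eqxx scaler_sumr; congr (_ + _).
by apply: eq_bigr => j /negbTE ->.
Qed.

(** If [K] is not the whole half-space of [v], take [x] in the half-space outside [K]. Then [K]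
    enlarged by the nonnegative multiples of [- x] still misses 0, and separating it yields the
    second functional. *)
Lemma half_space_or_two_functionals K : open_cone K -> K !=set0 -> ~ K 0 ->
  (exists v, K = [set x | 0 < dotp x v]) \/
  (exists v1 v2 x, [/\ forall y, K y -> 0 < dotp y v1,
     forall y, K y -> 0 < dotp y v2, 0 < dotp x v1 & dotp x v2 <= 0]).
Proof.
move=> cK [k Kk] K0; have [oK KD KZ] := cK.
have [|v Kv] := open_cone_separation cK _ K0; first by exists k.
have [[x [xv nKx]]|nx] := pselect (exists x, 0 < dotp x v /\ ~ K x); last first.
  left; exists v; apply/seteqP; split=> // x xv.
  by apply: contrapT => nKx; apply: nx; exists x.
right; pose K' := [set y | exists2 t, 0 <= t & K (y + t *: x)].
have cK' : open_cone K'.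
  split=> [|y z [s s0 Ks] [t t0 Kt]|s y s0 [t t0 Kt]].
  - rewrite (_ : K' = \bigcup_(t in [set t | 0 <= t]) [set y | K (y + t *: x)]).
      apply: bigcup_open => t _.
      apply: (@open_comp _ _ (fun y => y + t *: x)) => // y _.
      exact: cvgD cvg_id (cvg_cst _).
    by apply/seteqP; split=> y [t t0 ty]; exists t.
  - exists (s + t); first exact: addr_ge0.
    by rewrite scalerDl addrACA; exact: KD.
  - exists (s * t); first by rewrite mulr_ge0// ltW.
    by rewrite -scalerA -scalerDr; exact: KZ.
have KK' : K `<=` K' by move=> y Ky; exists 0; rewrite ?scale0r ?addr0.
have K'0 : ~ K' 0.
  move=> [t]; rewrite add0r le_eqVlt => /orP[/eqP <-|t0 Kt].
    by rewrite scale0r.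
  apply: nKx; have := KZ t^-1 _ _ Kt; rewrite scalerA mulVf ?gt_eqF// scale1r.
  by rewrite invr_gt0; apply.
have [|w K'w] := open_cone_separation cK' _ K'0; first by exists k; exact: KK'.
exists v, w, x; split=> // [y /KK'|]; first exact: K'w.
rewrite leNgt; apply/negP => xw.
have kw : 0 < dotp k w by apply: K'w; exact: KK'.
pose t := dotp k w / dotp x w.
have t0 : 0 < t by rewrite divr_gt0.
have : K' (k - t *: x) by exists t; rewrite ?subrK// ltW.
by move=> /K'w; rewrite dotpDl dotpNl dotpZl /t divfK ?gt_eqF// subrr ltxx.
Qed.

(** A small step along [w] leaves the hyperplane orthogonal to [w], so the hyperplanes can be
    removed one at a time. *)
Lemma avoid_hyperplanes (W : set 'rV[R]_n) (s : seq 'rV[R]_n) :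
  open W -> W !=set0 -> (forall w, w \in s -> w != 0) ->
  exists2 c, W c & forall w, w \in s -> dotp c w != 0.
Proof.
elim: s W => [W _ [c Wc] _|w s IH W oW [c Wc] s0]; first by exists c.
have [||y ys|d [Wd dw] ds] := IH (W `&` [set y | dotp y w != 0]).
- apply: openI => //.
  apply: (@open_comp _ _ (fun y => dotp y w) [set t | t != 0]).
    by move=> y _; exact: dotpl_continuous.
  exact: open_neq.
- have [cw|cw] := eqVneq (dotp c w) 0; last by exists c.
  have [e e0 We] := open_line w oW Wc.
  exists (c + (e / 2) *: w); split=> /=; first by apply: We; rewrite gtr0_norm; lra.
  rewrite dotpDl cw add0r dotpZl mulf_neq0//; first by rewrite gt_eqF// divr_gt0.
  by rewrite gt_eqF// dotpp_gt0// s0// mem_head.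
- by apply: s0; rewrite in_cons ys orbT.
- exists d => // y; rewrite in_cons => /orP[/eqP ->//|]; exact: ds.
Qed.

(** Otherwise [K] would be open and closed in the connected segment, and so contain its end [x]. *)
Lemma segment_boundary K x y : open K -> ~ closure K x -> K y ->
  exists2 t, 0 < t <= 1 & closure K ((1 - t) *: x + t *: y) /\
    ~ K ((1 - t) *: x + t *: y).
Proof.
move=> oK nKx Ky; pose q t := (1 - t) *: x + t *: y.
apply: contrapT => nt.
have qK t : 0 <= t <= 1 -> closure K (q t) -> K (q t).
  rewrite le_eqVlt => /andP[/orP[/eqP <-|t0] t1 Kt].
    by move: Kt; rewrite /q subr0 scale1r scale0r addr0 => /nKx.
  by apply: contrapT => nKt; apply: nt; exists t => //; rewrite t0.
have cq : continuous q.
  move=> t; apply: cvgD; apply: cvgZl; last exact: cvg_id.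
  exact: cvgB (cvg_cst _) cvg_id.
have q0 : q 0 = x by rewrite /q subr0 scale1r scale0r addr0.
have q1 : q 1 = y by rewrite /q subrr scale1r scale0r add0r.
suff /seteqP[_ /(_ 0)[]] : `[0, 1] `&` (q @^-1` K) = `[0, 1]%classic.
- by rewrite /= in_itv /= lexx ler01.
- by move=> _ /= ; rewrite q0 => /(@subset_closure _ K).
apply: (@segment_connected R 0 1).
- by exists 1; split=> /=; [rewrite in_itv /= ler01 lexx|rewrite q1].
- exists (q @^-1` K) => //.
  by apply: open_comp => // t _; exact: cq.
- exists (q @^-1` closure K).
    by apply: closed_comp; [move=> t _; exact: cq|exact: closed_closure].
  apply/seteqP; split=> t [t01 Kt]; split=> //; first exact: subset_closure.
  by apply: qK.
Qed.

End MinkowskiSums.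

(** * Convexity of the cones over components *)

Section Convexity.
Variables (R : realType) (n : nat) (n_gt0 : (0 < n)%N).
Implicit Types (U C : set (sphere R n)).

Lemma tame_minimally_balanced U (g : 'I_n.+1 -> 'rV[R]_n) : tame n U ->
  (forall i, cone_over U (g i)) -> minimally_balanced g.
Proof.
move=> tU gU l l0 lg j lj i; apply/eqP; apply: contrapT => /negP li.
have [k iE] : exists k, i = lift j k.
  case: (unliftP j i) => [k ->|ij]; first by exists k.
  by rewrite ij lj eqxx in li.
apply: (@tame_not_balanced _ _ n_gt0 U (fun k => g (lift j k))) => //.
exists (fun k => l (lift j k)); split => //.
  by exists k; rewrite -iE lt_neqAle eq_sym li l0.
by move: lg; rewrite (bigD1_ord j)//= lj scale0r add0r.
Qed.

(* If [a + c] with [a], [c] over [C] were balanced by [n - 1] points of [U],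
   then so would be [a' + c] with [a'] proportional to [c], because [C] is
   connected; this would be a balanced set of only [n] points. *)
Lemma cone_over_component_not_balanced U C a c (x : 'I_n -> sphere R n)
    (b : 'I_n -> R) j : tame n U -> components U C ->
  cone_over C a -> cone_over C c -> (forall i, U (x i)) ->
  (forall i, 0 <= b i) -> b j = 0 -> a + c + \sum_i b i *: \val (x i) != 0.
Proof.
move=> tU cC [t [p [t0 Cp ->]]] [s [q [s0 Cq cE]]] Ux b0 bj; apply/eqP => ac0.
(* The slot [j], vacant since [b j = 0], receives [c]; only the vector [z] of [g] moves. *)
pose f i := if i == j then c else \val (x i).
have Uf i : cone_over U (f i).
  rewrite /f; case: ifP => _; last exact: cone_over_val.
  by exists s, q; split => //; exact: component_subset Cq.
pose g (z : sphere R n) i := if unlift ord0 i is Some k then f k else \val z.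
have bg : balanced (g p).
  exists (fun i => if unlift ord0 i is Some k then if k == j then 1 else b k else t).
  split.
  - by move=> i; case: unlift => [k|]; [case: ifP|exact: ltW].
  - by exists ord0; rewrite unlift_none.
  - rewrite /g big_ord_recl unlift_none -[RHS]ac0 -addrA; congr (_ + _).
    under eq_bigr do rewrite liftK.
    rewrite (bigD1 j)//= [in RHS](bigD1 j)//= /f eqxx scale1r bj scale0r add0r.
    by congr (_ + _); apply: eq_bigr => i /negbTE ->.
have [l [l0 [i0 li0] lg]] : balanced (g q).
  apply: (balanced_connected n_gt0 (connected_components cC) _ _ Cp Cq bg).
    move=> i; rewrite /g; case: unlift => [k|]; first exact: cst_continuous.
    exact: val_sphere_continuous.
  move=> z Cz; apply: (tame_minimally_balanced tU) => i; rewrite /g.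
  by case: unlift => // ; exact/cone_over_val/(component_subset cC).
(* At [z = q] the moving vector is proportional to [c = s *: q], so its coefficient is merged into
   the slot [j]. *)
pose m k := l (lift ord0 k) + (if k == j then l ord0 / s else 0).
have m0 k : 0 <= m k.
  by rewrite addr_ge0//; case: ifP => // _; rewrite divr_ge0// ltW.
apply: (tame_not_balanced n_gt0 tU Uf); exists m; split => //.
- case: (unliftP ord0 i0) li0 => [k ->|->] li0.
    exists k; rewrite /m ltr_pwDl//; case: ifP => // _.
    by rewrite divr_ge0// ltW.
  by exists j; rewrite /m eqxx ltr_wpDl// divr_gt0.
- rewrite -[RHS]lg big_ord_recl {1}/g unlift_none.
  under eq_bigr do rewrite /m scalerDl.
  rewrite big_split /= addrC; congr (_ + _); last first.
    by apply: eq_bigr => k _; rewrite /g liftK.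
  rewrite (bigD1 j)//= eqxx big1 ?addr0.
    by rewrite /f eqxx cE scalerA divfK// gt_eqF.
  by move=> i /negbTE ->; rewrite scale0r.
Qed.

(** Maximality is applied to the sum [W] of small convex cones around [x] and [y]: its elements are
    sums of two vectors over [C], hence not balanced by [n - 1] points of [U]. *)
Lemma open_cone_component U C : weakly_maxtame U -> components U C ->
  open_cone (cone_over C).
Proof.
move=> wU cC; have [oU tU _ _] := wU; have oC := open_component oU cC.
split; [exact: open_cone_over| |by move=> t x; exact: cone_overZ].
move=> x y Cx Cy.
have [A [cA Ax AC]] := small_open_cone (open_cone_over oC) (@cone_overZ _ _ C) Cx.
have [B [cB By BC]] := small_open_cone (open_cone_over oC) (@cone_overZ _ _ C) Cy.
pose W := minkowski_sum (fun i : bool => if i then A else B).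
have cW : open_cone W by apply: (open_cone_minkowski_sum true) => -[].
have WAB a b : A a -> B b -> W (a + b).
  move=> Aa Bb; exists (fun i : bool => if i then a else b); first by case.
  by rewrite big_bool.
have nb k (z : 'I_n -> sphere R n) (b : 'I_n -> R) j : W k ->
    (forall i, U (z i)) -> (forall i, 0 <= b i) -> b j = 0 ->
    k + \sum_i b i *: \val (z i) != 0.
  move=> [f Wf ->]; rewrite big_bool.
  apply: (cone_over_component_not_balanced tU cC); first exact: AC (Wf true).
  exact: BC (Wf false).
have WC : forall p, W (\val p) -> C p.
  apply: (maximal_cone n_gt0 wU cC cW) => //.
  (* [W] meets [C] because [x] plus a small multiple of [y] is still over [C]. *)
  have [d d0 dC] := open_line y (open_cone_over oC) Cx.
  have [|t [p [t0 Cp tp]]] := dC (d / 2); first by rewrite gtr0_norm; lra.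
  exists p => //; have [_ _ WZ] := cW; have [_ _ BZ] := cB.
  have -> : \val p = t^-1 *: (x + (d / 2) *: y).
    by rewrite tp scalerA mulVf ?scale1r// gt_eqF.
  apply: WZ; first by rewrite invr_gt0.
  by apply: WAB => //; apply: BZ => //; lra.
have Wxy : W (x + y) by exact: WAB.
have xy0 : x + y != 0.
  have [p Cp] := component_nonempty cC.
  have := nb _ (fun=> p) (fun=> 0) (Ordinal n_gt0) Wxy.
  rewrite big1 ?addr0; last by move=> i _; rewrite scale0r.
  by apply => // i; exact: component_subset cC _ Cp.
have [t [p [t0 xyE]]] := coneP xy0; exists t, p; split => //.
apply: WC; have [_ _ WZ] := cW.
have -> : \val p = t^-1 *: (x + y) by rewrite xyE scalerA mulVf ?scale1r// gt_eqF.
by apply: WZ => //; rewrite invr_gt0.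
Qed.

End Convexity.

(** * Sums of [n] component cones and the wall hemispheres *)

Section Main.
Variables (R : realType) (n : nat) (n_gt0 : (0 < n)%N) (U : set (sphere R n)).
Hypothesis wU : weakly_maxtame U.
Implicit Types (C H : set (sphere R n)) (D : 'I_n -> set (sphere R n)).

Definition sum_cone D : set 'rV[R]_n := minkowski_sum (fun i => cone_over (D i)).

Lemma open_cone_sum_cone D : (forall i, components U (D i)) ->
  open_cone (sum_cone D).
Proof.
move=> cD; apply: (open_cone_minkowski_sum (Ordinal n_gt0)) => i.
exact: open_cone_component wU (cD i).
Qed.

Lemma sum_cone_nonempty D : (forall i, components U (D i)) -> sum_cone D !=set0.
Proof.
move=> cD; have /choice[p Dp] : forall i, exists p, D i p.
  by move=> i; have [p] := component_nonempty (cD i); exists p.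
exists (\sum_i \val (p i)); exists (fun i => \val (p i)) => // i.
exact: cone_over_val.
Qed.

Lemma sum_cone0 D : (forall i, components U (D i)) -> ~ sum_cone D 0.
Proof.
move=> cD [f Df f0]; have [_ tU _ _] := wU.
apply: (tame_not_balanced n_gt0 (f := f) tU).
  by move=> i; apply: cone_overS (Df i); exact: component_subset (cD i).
exists (fun=> 1); split=> //; first by exists (Ordinal n_gt0).
by under eq_bigr do rewrite scale1r.
Qed.

Lemma sum_cone_gt0 D v : (forall i, components U (D i)) ->
  (forall x, sum_cone D x -> 0 < dotp x v) ->
  forall i p, D i p -> 0 < dotp (\val p) v.
Proof.
move=> cD Dv i p Dp; apply: (minkowski_sum_gt0 _ _ Dv (i := i)).
- by move=> j; exact: open_cone_component wU (cD j).
- move=> j; have [q Dq] := component_nonempty (cD j).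
  by exists (\val q); exact: cone_over_val.
- exact: cone_over_val.
Qed.

(* Near a point [p] of [v^perp], a point [q] of [U] with [<q, v> < 0] would be
   balanced by points [f i] of the cones over the [D i].  Moving [f] to a fixed
   family [f'], which does not balance [p] and hence does not balance [q], some
   [n] of the [n + 1] points become balanced on the way. *)
Lemma half_space_gap D v (p : sphere R n) : (forall i, components U (D i)) ->
  sum_cone D = [set x | 0 < dotp x v] -> 0 <= dotp (\val p) v ->
  ~ closure (U `&` [set q | dotp (\val q) v < 0]) p.
Proof.
move=> cD DvE; have [_ tU _ _] := wU.
have nbhs_gt0 u (r : sphere R n) : 0 < dotp (\val r) u ->
    nbhs r [set q : sphere R n | 0 < dotp (\val q) u].
  move=> ru; have := open_val_preimage (@open_dotp_gt0 _ _ u); rewrite openE.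
  exact.
rewrite le_eqVlt => /orP[/eqP/esym pv|pv]; last first.
  move=> /(_ _ (nbhs_gt0 _ _ pv)) [q [[_ /= qv] /= qv']].
  by have := lt_trans qv qv'; rewrite ltxx.
have /choice[r Dr] : forall i, exists r, D i r.
  by move=> i; have [r] := component_nonempty (cD i); exists r.
have Dv : forall x, sum_cone D x -> 0 < dotp x v by rewrite DvE.
pose g (q : sphere R n) (f : 'I_n -> 'rV[R]_n) i :=
  if unlift ord0 i is Some k then f k else \val q.
(* If [p] and the [r i] were balanced, pairing with [v] would kill the coefficients of the [r i] and
   leave a positive multiple of [p] equal to 0. *)
have [[u gu]|[l [l0 [i0 li0] lg]]] := gordan (g p (fun i => \val (r i))); last first.
  have lS k : l (lift ord0 k) = 0.
    have : \sum_i l (lift ord0 i) * dotp (\val (r i)) v = 0.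
      rewrite -[RHS](dotp0l v) -lg big_ord_recl dotpDl dotpZl /g unlift_none pv.
      rewrite mulr0 add0r dotp_suml; apply: eq_bigr => i _.
      by rewrite liftK dotpZl.
    have rv i : 0 < dotp (\val (r i)) v by exact: sum_cone_gt0 Dv i _ (Dr i).
    move/psumr_eq0P => /(_ _ k isT)/eqP; rewrite mulf_eq0 (gt_eqF (rv k)) orbF.
    move=> lk; apply/eqP; apply: lk => i _.
    by rewrite mulr_ge0// ltW.
  case: (unliftP ord0 i0) li0 => [k ->|->]; first by rewrite lS ltxx.
  move: lg; rewrite big_ord_recl big1 => [|i _]; last by rewrite lS scale0r.
  rewrite addr0 /g unlift_none => /eqP; rewrite scaler_eq0.
  by rewrite (negbTE (sphere_neq0 p)) orbF => /eqP ->; rewrite ltxx.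
have pu : 0 < dotp (\val p) u by have := gu ord0; rewrite /g unlift_none.
move=> /(_ _ (nbhs_gt0 _ _ pu)) [q [[Uq /= qv] /= qu]].
have : sum_cone D (- \val q) by rewrite DvE /= dotpNl oppr_gt0.
move=> [f Df qf].
pose h t := g q (fun i => (1 - t) *: f i + t *: \val (r i)).
have : balanced (h 1).
  apply: (@balanced_connected _ _ n_gt0 R `[0, 1]%classic h _ _ _ 0).
  - exact: segment_connected.
  - move=> i t; rewrite /h /g; case: unlift => [k|]; last exact: cvg_cst.
    apply: cvgD; apply: cvgZl; last exact: cvg_id.
    exact: cvgB (cvg_cst _) cvg_id.
  - move=> t; rewrite /= in_itv /= => /andP[t0 t1].
    apply: (tame_minimally_balanced n_gt0 tU) => i; rewrite /h /g.
    case: unlift => [k|]; last exact: cone_over_val.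
    apply: cone_overS (component_subset (cD k)) _ _.
    have [_ KD KZ] := open_cone_component n_gt0 wU (cD k).
    have [->|t'0] := eqVneq t 0; first by rewrite subr0 scale1r scale0r addr0.
    have [->|t'1] := eqVneq t 1.
      by rewrite subrr scale1r scale0r add0r; exact: cone_over_val.
    apply: KD; apply: KZ => //; last exact: cone_over_val.
      by rewrite subr_gt0 lt_neqAle t'1.
    by rewrite lt_neqAle eq_sym t'0.
  - by rewrite /= in_itv /= lexx ler01.
  - by rewrite /= in_itv /= lexx ler01.
  - exists (fun=> 1); split=> //; first by exists ord0.
    rewrite big_ord_recl /h /g unlift_none scale1r.
    under eq_bigr do rewrite liftK scale1r subr0 scale1r scale0r addr0.
    by rewrite -qf subrr.
apply: (@not_balanced _ _ _ _ u) => i; have := gu i.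
rewrite /h /g; case: unlift => [k|//].
by rewrite subrr scale0r add0r scale1r.
Qed.

Definition wall_hemisphere H : Prop := exists2 D, (forall i, components U (D i)) &
  exists2 v : sphere R n, H = hemisphere v &
    sum_cone D = [set x | 0 < dotp x (\val v)].

(** Numbering the components makes the families of [n] of them a finite type, over which open
    conditions can be intersected. *)
Lemma enum_components : exists (k : nat) (c : 'I_k -> set (sphere R n)),
  (forall i, components U (c i)) /\
  (forall C, components U C -> exists i, c i = C).
Proof.
have [_ _ /finite_seqP[s sE] _] := wU.
exists (size s), (fun i => nth set0 s i); split=> [i|C].
  by rewrite sE /=; exact: mem_nth.
rewrite sE /= => Cs; have Cs' := Cs; rewrite -index_mem in Cs'.
by exists (Ordinal Cs'); rewrite /= nth_index.
Qed.

Lemma finite_wall_hemisphere : finite_set wall_hemisphere.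
Proof.
have [k [c [cc cP]]] := enum_components.
pose F (f : {ffun 'I_n -> 'I_k}) :=
  [set p : sphere R n | sum_cone (c \o f) (\val p)].
apply: (@sub_finite_set _ _ (F @` setT)); last exact/finite_image/finite_finset.
move=> H [D cD [v -> Dv]].
have /choice[f fD] : forall i, exists j, c j = D i by move=> i; exact: cP.
exists (finfun f) => //; rewrite /F /hemisphere.
have -> : c \o finfun f = D by apply/funext => i /=; rewrite ffunE.
by rewrite Dv.
Qed.

(* Suppose that the point [p] outside [C] belongs to every wall hemisphere
   containing [C].  Move from a point near [p] to a generic point of [C], up to
   the boundary of [C].  At the boundary point [q] reached, every sum of cones
   involving [C] has a functional that is positive at [q]: it is a half-space
   containing [p], or it has two independent functionals, which do not both
   vanish at [q].  The intersection of these half-spaces contains [C] and [q],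
   against the maximality of [U]. *)
Lemma component_wall_hemispheres C (p : sphere R n) : components U C ->
  (forall H, wall_hemisphere H -> C `<=` H -> H p) -> C p.
Proof.
move=> cC wall; apply: contrapT => nCp.
have [oU tU _ _] := wU.
have [k [c [cc cP]]] := enum_components.
have [ic icE] := cP _ cC.
pose K (f : {ffun 'I_n -> 'I_k}) := sum_cone (c \o f).
pose meets (f : {ffun 'I_n -> 'I_k}) := exists i, f i = ic.
have cK (f : {ffun 'I_n -> 'I_k}) : forall i, components U ((c \o f) i) by move=> i; exact: cc.
have oK f : open_cone (K f) := open_cone_sum_cone (cK f).
have cC0 := open_cone_component n_gt0 wU cC; have [oC CD CZ] := cC0.
pose good f := exists v, K f = [set x | 0 < dotp x v].
have K_C f v : meets f -> (forall x, K f x -> 0 < dotp x v) ->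
    forall x, cone_over C x -> 0 < dotp x v.
  move=> [i fi] Kv x [t [q [t0 Cq ->]]]; rewrite dotpZl mulr_gt0//.
  by apply: (sum_cone_gt0 (cK f) Kv (i := i)); rewrite /= fi icE.
pose Y := [set y | forall f, meets f /\ good f -> K f y].
have oY : open Y.
  apply: (@open_forall _ _ (fun f y => meets f /\ good f -> K f y)) => f.
  by apply: open_imply; case: (oK f).
have Yp : Y (\val p).
  move=> f [mf [v Kv]]; rewrite Kv /=.
  have [x Kx] := sum_cone_nonempty (cK f).
  have v0 : v != 0.
    apply/eqP => v0; have : K f x by [].
    by rewrite Kv /= v0 dotp0r ltxx.
  have [t [q [t0 vE]]] := coneP v0.
  have Kq : K f = [set x | 0 < dotp x (\val q)].
    by rewrite Kv; apply/seteqP; split=> y /=; rewrite vE dotpZr pmulr_rgt0.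
  rewrite vE dotpZr pmulr_rgt0//; apply: (wall (hemisphere q)).
    by exists (c \o f) => //; exists q.
  move=> r Cr; apply: (K_C f (\val q) mf); last exact: cone_over_val.
  by rewrite Kq.
have [p0 Cp0] := component_nonempty cC; have C0 := cone_over_val Cp0.
(* Pushing [p] slightly away from [p0] leaves the closure of the cone: otherwise adding the multiple
   of [p0] back would put [p] in [C]. *)
have [x Yx nCx] : exists2 x, Y x & ~ closure (cone_over C) x.
  have [d d0 Yd] := open_line (- \val p0) oY Yp.
  exists (\val p + (d / 2) *: - \val p0); first by apply: Yd; rewrite gtr0_norm; lra.
  move=> Cx; apply: nCp; apply: cone_over_valK.
  have : cone_over C ((d / 2) *: \val p0) by apply: CZ => //; lra.
  by move=> /(open_cone_closureD cC0 Cx); rewrite scalerN subrK.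
(* [w] depends only on [f] and [x], so [y] can be chosen afterwards off all the hyperplanes. If both
   functionals vanished at [q], then [w], a combination of them vanishing at [x], would give 0 at
   [y]. For half-spaces any nonzero [w] serves. *)
have key f : exists w, w != 0 /\ (meets f -> forall y t q,
    q = (1 - t) *: x + t *: y -> 0 < t -> dotp y w != 0 ->
    closure (cone_over C) q -> (good f -> K f q) ->
    exists2 v, forall z, K f z -> 0 < dotp z v & 0 < dotp q v).
  have [gf|[v1 [v2 [z [Kv1 Kv2 zv1 zv2]]]]] :=
    half_space_or_two_functionals (oK f) (sum_cone_nonempty (cK f)) (sum_cone0 (cK f)).
    exists (\val p0); split; first exact: sphere_neq0.
    move=> _ y t q _ _ _ _ /(_ gf); case: gf => v Kv Kq; exists v; first by rewrite Kv.
    by move: Kq; rewrite Kv.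
  have [a [b [w0 xw]]] : exists a b, a *: v1 + b *: v2 != 0 /\
      a * dotp x v1 + b * dotp x v2 = 0.
    have [y Ky] := sum_cone_nonempty (cK f).
    have yv1 := Kv1 _ Ky; have yv2 := Kv2 _ Ky.
    (* If this combination is zero, evaluating it at [y] and [z] shows that both functionals vanish
       at [x], and [v1] itself serves. *)
    have [v12|] := eqVneq (dotp x v2 *: v1 + - dotp x v1 *: v2) 0; last first.
      by exists (dotp x v2), (- dotp x v1); split => //; ring.
    have := congr1 (dotp y) v12; have := congr1 (dotp z) v12.
    rewrite !dotp0r !dotpDr !dotpZr => zv yv.
    have xv2 : dotp x v2 = 0.
      apply/eqP; rewrite eq_le; apply/andP; split; rewrite leNgt; apply/negP => xv2.
        have : 0 < dotp x v1 by move: yv; nra.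
        by move: zv; nra.
      have : dotp x v1 < 0 by move: yv; nra.
      by move: zv; nra.
    exists 1, 0; rewrite scale1r scale0r addr0; split.
      by apply/eqP => v10; rewrite v10 dotp0r ltxx in yv1.
    by move: yv; rewrite xv2; nra.
  exists (a *: v1 + b *: v2); split; first exact: w0.
  move=> mf y t q qE t0 yw Cq _.
  have ge0 v : (forall z, K f z -> 0 < dotp z v) -> 0 <= dotp q v.
    move=> /(K_C _ _ mf) Cv.
    have : closure [set z | 0 <= dotp z v] q.
      by apply: closure_subset Cq => r /Cv/ltW.
    exact: closed_dotp_ge0.
  have := ge0 _ Kv1; rewrite le_eqVlt => /orP[/eqP qv1|]; last by exists v1.
  have := ge0 _ Kv2; rewrite le_eqVlt => /orP[/eqP qv2|]; last by exists v2.
  exfalso; move/negP: yw; apply.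
  have : dotp q (a *: v1 + b *: v2) = 0 by rewrite dotpDr !dotpZr -qv1 -qv2; ring.
  have xw' : dotp x (a *: v1 + b *: v2) = 0 by rewrite dotpDr !dotpZr.
  rewrite qE dotpDl !dotpZl xw' mulr0 add0r => /eqP.
  by rewrite mulf_eq0 (gt_eqF t0).
have {key} [w /all_and2[w0 key]] := choice key.
have [||y Cy yw] := @avoid_hyperplanes _ _ (cone_over C) (map w (enum predT)) oC.
- by exists (\val p0).
- by move=> _ /mapP[f _ ->].
have {}yw f : dotp y (w f) != 0 by apply: yw; rewrite map_f ?mem_enum.
have [t /andP[t0 t1] [Cq nCq]] := segment_boundary oC nCx Cy.
have [q qE] : exists q, q = (1 - t) *: x + t *: y by exists ((1 - t) *: x + t *: y).
rewrite -qE in Cq nCq.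
have /choice[v vP] : forall f, exists v,
    meets f -> (forall z, K f z -> 0 < dotp z v) /\ 0 < dotp q v.
  move=> f; have [mf|nmf] := pselect (meets f); last by exists 0 => /nmf.
  have Kq : good f -> K f q.
    move=> gf; have [v Kv] := gf; have xv := Yx f (conj mf gf).
    have Kv' z : K f z -> 0 < dotp z v by rewrite Kv.
    have yv := K_C f v mf Kv' _ Cy.
    rewrite Kv /= qE dotpDl !dotpZl ltr_wpDl ?mulr_gt0//.
    by rewrite mulr_ge0 ?subr_ge0// ltW// Kv'.
  have [v Kv qv] := key f mf y t q qE t0 (yw f) Cq Kq.
  by exists v => _; split.
pose W := [set z | forall f, meets f -> 0 < dotp z (v f)].
have cW : open_cone W.
  split=> [|a b Wa Wb f mf|s a s0 Wa f mf].
  - apply: (@open_forall _ _ (fun f z => meets f -> 0 < dotp z (v f))) => f.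
    by apply: open_imply; exact: open_dotp_gt0.
  - by rewrite dotpDl addr_gt0//; [exact: Wa|exact: Wb].
  - by rewrite dotpZl mulr_gt0//; exact: Wa.
have CW : cone_over C `<=` W.
  by move=> z Cz f mf; apply: (K_C f (v f) mf) => //; have [] := vP f mf.
have WC : forall r, W (\val r) -> C r.
  apply: (maximal_cone n_gt0 wU cC cW); first by exists p0 => //; exact: CW.
  move=> a z b j Wa Uz b0 bj.
  have /choice[g gz] : forall i, exists m, c m (z i).
    move=> i; have [|m mE] := cP (connected_component U (z i)).
      by exists (z i).
    by exists m; rewrite mE; exact: connected_component_refl.
  (* The vacant slot [j] goes to [C], so that [v f] is available: positive at [a], nonnegative on
     the sum. *)
  pose f := [ffun i => if i == j then ic else g i].
  have mf : meets f by exists j; rewrite ffunE eqxx.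
  have [Kv _] := vP f mf.
  apply/eqP => abz; have : 0 < dotp (a + \sum_i b i *: \val (z i)) (v f).
    rewrite dotpDl dotp_suml ltr_wpDr//; last exact: Wa.
    apply: sumr_ge0 => i _; rewrite dotpZl.
    have [->|ij] := eqVneq i j; first by rewrite bj mul0r.
    rewrite mulr_ge0// ltW//; apply: (sum_cone_gt0 (cK f) Kv (i := i)).
    by rewrite /= ffunE (negbTE ij).
  by rewrite abz dotp0l ltxx.
have Wq : W q by move=> f mf; have [] := vP f mf.
have q0 : q != 0.
  have m0 : meets [ffun=> ic] by exists (Ordinal n_gt0); rewrite ffunE.
  by apply/eqP => q0; have := Wq _ m0; rewrite q0 dotp0l ltxx.
have [s [r [s0 rE]]] := coneP q0; apply: nCq; rewrite rE; exists s, r.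
split => //; apply: WC; have [_ _ WZ] := cW.
have -> : \val r = s^-1 *: q by rewrite rE scalerA mulVf ?scale1r// gt_eqF.
by apply: WZ => //; rewrite invr_gt0.
Qed.

(** [N] is the complement of the closure of the part of [U] strictly behind the wall; the gap keeps
    this closure away from the closed hemisphere. *)
Lemma wall_hemisphere_gap H : wall_hemisphere H ->
  exists2 N : set (sphere R n), set_nbhs (closure H) N & U `&` H = U `&` N.
Proof.
move=> [D cD [v -> Dv]]; have [oU _ _ _] := wU.
pose B := U `&` [set q : sphere R n | dotp (\val q) (\val v) < 0].
exists (~` closure B).
  move=> p Hp; apply: open_nbhs_nbhs; split.
    by rewrite openC; exact: closed_closure.
  apply: (half_space_gap cD Dv).
  have cl : closed [set q : sphere R n | 0 <= dotp (\val q) (\val v)].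
    apply: (@closed_comp _ _ (\val : sphere R n -> 'rV[R]_n)
      [set x | 0 <= dotp x (\val v)]); last exact: closed_dotp_ge0.
    by move=> q _; exact: val_sphere_continuous.
  by apply: cl; apply: closure_subset Hp => q; rewrite /hemisphere /= => /ltW.
apply/seteqP; split=> p [Up Hp]; split=> //.
  by apply: (half_space_gap cD Dv); exact: ltW.
(* A point of [U] on the wall can be pushed along [- \val v] within [U], so it is a limit of points
   behind the wall. *)
rewrite /hemisphere /= ltNge le_eqVlt; apply/negP => /orP[/eqP pv|pv]; last first.
  by apply: Hp; exact: subset_closure.
apply: Hp => A; rewrite nbhsE => -[A' [oA' A'p] A'A].
have oUA := open_cone_over (openI oU oA').
have [d d0 dUA] := open_line (- \val v) oUA (cone_over_val (conj Up A'p)).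
have [|t [q [t0 [Uq A'q] qE]]] := dUA (d / 2); first by rewrite gtr0_norm; lra.
exists q; split; [split=> //=|exact: A'A].
have := congr1 (fun x => dotp x (\val v)) qE.
rewrite dotpDl !dotpZl dotpNl pv add0r dotp_sphere => tq.
by rewrite -(pmulr_rlt0 _ t0) -tq; lra.
Qed.

End Main.

Theorem theoremA (R : realType) (n : nat) (n_ge1 : (1 <= n)%N)
    (U : set (sphere R n)) (U_wmt : weakly_maxtame U) :
  (exists HH : set (set (sphere R n)),
    [/\ finite_set HH,
        forall H, HH H -> exists v : sphere R n, H = hemisphere v,
        forall C, components U C ->
          exists G : set (set (sphere R n)),
            [/\ G `<=` HH, G !=set0 & C = \bigcap_(H in G) H] &
        forall H, HH H ->
          exists2 N : set (sphere R n),
            set_nbhs (closure H) N & U `&` H = U `&` N])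
  /\ (forall C D, components U C -> components U D -> C <> D ->
        closure C `&` closure D = set0).
Proof.
have meet_walls C : components U C ->
    C = \bigcap_(H in [set H | wall_hemisphere U H /\ C `<=` H]) H.
  move=> cC; apply/seteqP; split=> [p Cp H [_]|p Hp]; first exact.
  by apply: (component_wall_hemispheres n_ge1 U_wmt cC) => H wH CH; exact: Hp.
split.
- exists (wall_hemisphere U); split.
  + exact: finite_wall_hemisphere.
  + by move=> H [D _ [v -> _]]; exists v.
  + move=> C cC; exists [set H | wall_hemisphere U H /\ C `<=` H].
    split; [by move=> H []| |exact: meet_walls].
    (* Without walls [C] would be the whole sphere, and the convex cone over it would contain
       opposite vectors, hence 0. *)
    apply: contrapT => G0; have [p Cp] := component_nonempty cC.
    have Call q : C q.
      rewrite (meet_walls C cC) => H GH; exfalso; apply: G0; by exists H.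
    have np0 : - \val p != 0 by rewrite oppr_eq0 sphere_neq0.
    have [t [q [t0 pq]]] := coneP np0.
    have [_ CD _] := open_cone_component n_ge1 U_wmt cC.
    apply: (@cone_over0 _ _ C); rewrite -(subrr (\val p)); apply: CD.
      exact: cone_over_val.
    by exists t, q.
  + exact: wall_hemisphere_gap.
- move=> C D cC cD CD; apply/seteqP; split=> // r [Cr Dr].
  (* If [D] lay in every wall hemisphere containing [C], its points would lie in the intersection,
     which is [C]. *)
  have [H [wH CH] nDH] : exists2 H, wall_hemisphere U H /\ C `<=` H & ~ D `<=` H.
    apply: contrapT => nH; apply: CD; have [p Dp] := component_nonempty cD.
    apply: (components_eq cC cD _ Dp); rewrite (meet_walls C cC) => H GH.
    by have [DH|nDH] := pselect (D `<=` H); [exact: DH|case: nH; exists H].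
  have [N HN UHN] := wall_hemisphere_gap n_ge1 U_wmt wH.
  have NH p : D p -> N p -> H p.
    move=> /(component_subset cD) Up Np.
    by have : (U `&` N) p by []; rewrite -UHN => -[].
  have HNr : nbhs r N by apply: HN; exact: closure_subset CH _ Cr.
  have [p [Dp /(NH _ Dp) Hp]] := Dr _ HNr.
  (* By the gap, the trace of [H] on [D] is open and closed in [D]; it contains the point [p] of [D]
     in [N], so connectedness puts [D] inside [H]. *)
  apply: nDH; suff <- : D `&` H = D by exact: subIsetr.
  apply: (connected_components cD); first by exists p.
    exists H => //; have [E _ [v -> _]] := wH.
    exact: (@open_val_preimage _ _ _ (@open_dotp_gt0 _ _ (\val v))).
  exists (closure H); first exact: closed_closure.
  apply/seteqP; split=> q [Dq Hq]; split=> //; first exact: subset_closure.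
  by apply: NH => //; exact: nbhs_singleton (HN _ Hq).
Qed.
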